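(* Let $k\in\{1,\dots,6\}$ and let $p\in(1,\infty)$ be fixed. In the setting described in the context, let assumptions (A1)--(A3) hold, and let $\theta>\pi/2-\alpha_k$. Then there exist positive constants $\tau_0$ and $C$ (independent of $\tau$, but possibly depending on $T$) such that, for every stepsize $\tau\le\tau_0$, the $k$-step BDF method for the non-autonomous equation, $$\frac1\tau\sum_{j=0}^k\delta_jv_{n-j}+A(t_n)v_n=f_n,\qquad k\le n\le N,$$ with $f_n\in X$ and given starting values $v_0,\dots,v_{k-1}\in D$, satisfies $$\frac1\tau\big\|(v_n-v_{n-1})_{n=k}^N\big\|_{L^p(X)}+\big\|(v_n)_{n=k}^N\big\|_{L^p(D)}\le C\Big(\big\|(f_n)_{n=k}^N\big\|_{L^p(X)}+\frac1\tau\big\|(v_i)_{i=0}^{k-1}\big\|_{L^p(X)}+\big\|(v_i)_{i=0}^{k-1}\big\|_{L^p(D)}\Big).$$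
   Context: **Spaces and operators.** $V\hookrightarrow H=H'\hookrightarrow V'$ is a Gelfand triple of complex Hilbert spaces; the duality pairing $\langle\cdot,\cdot\rangle$ between $V$ and $V'$ restricted to $V\times H$ coincides with the inner product $(\cdot,\cdot)$ of $H$. $T>0$. $D,W,X$ are Banach spaces with imbeddings $D\subset W\subset X$, $D\subset V$, $X\subset V'$. For $t\in[0,T]$, $A(t):V\to V'$ are bounded linear operators which also map $D\to X$. **Time grid and norms.** $N\in\mathbb N$, $N\ge k$, $\tau=T/N$, $t_n=n\tau$. For a sequence in a Banach space $Y$, $\|(v_n)_{n=a}^b\|_{L^p(Y)}=\big(\tau\sum_{n=a}^b\|v_n\|_Y^p\big)^{1/p}$. **BDF coefficients.** $\delta(\zeta)=\sum_{\ell=1}^k\frac1\ell(1-\zeta)^\ell=\sum_{i=0}^k\delta_i\zeta^i$. $\alpha_k$ is the angle of A$(\alpha)$-stability of the $k$-step BDF method, i.e. the largest $\alpha\in(0,\pi/2]$ with $|\arg\delta(\zeta)|\le\pi-\alpha$ for $|\zeta|\le1$, $\zeta\neq1$: $\alpha_1=\alpha_2=90^\circ$, $\alpha_3\approx86.03^\circ$, $\alpha_4\approx73.35^\circ$, $\alpha_5\approx51.84^\circ$, $\alpha_6\approx17.84^\circ$. **Assumptions** ($\Sigma_\varphi=\{z\in\mathbb C\setminus\{0\}:|\arg z|<\varphi\}$). (A1) For all $s\in[0,T]$ and $v_0\in H$ there is a unique solution $v\in H^1(\mathbb R_+;V')\cap L^2(\mathbb R_+;V)\hookrightarrow C([0,\infty);H)$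 of $v'(t)+A(s)v(t)=0$, $t>0$, $v(0)=v_0$. The solution map $E_s^H(t):H\to H$, $v_0\mapsto v(t)$, extends to a bounded analytic semigroup $\{E_s^H(z)\}_{z\in\Sigma_{\theta_s}}$ on $H$, where $\theta_s\in(0,\pi/2]$ is the maximal angle of analyticity (the supremum of all such angles). The domain $D(A_H(s))=D_H\hookrightarrow V$ of the generator $-A_H(s)$ of this semigroup is independent of $s$ and compactly imbedded into $H$ (and $A_H(s)v=A(s)v$ for $v\in D_H$), and $\theta:=\inf_{s\in[0,T]}\theta_s>0$. (A2) If $\theta>\pi/2-\alpha_k$, then for all $s\in[0,T]$ the $k$-step BDF solution $v_k,\dots,v_N\in D$ determined by $\frac1\tau\sum_{j=0}^k\delta_jv_{n-j}+A(s)v_n=f_n$, $k\le n\le N$, with given $f_n\in X$ and starting values $v_0,\dots,v_{k-1}\in D$, satisfies $$\tfrac1\tau\|(v_n-v_{n-1})_{n=k}^N\|_{L^p(X)}+\|(v_n)_{n=k}^N\|_{L^p(D)}\le C\big(\|(f_n)_{n=k}^N\|_{L^p(X)}+\tfrac1\tau\|(v_i)_{i=0}^{k-1}\|_{L^p(X)}+\|(v_i)_{i=0}^{k-1}\|_{L^p(D)}\big)$$ with $C$ independent of $\tau$ and $s\in[0,T]$. (A3) There are positive constants $M_1,M_2$ with $\|A(t)\|_{\mathcal L(D,X)}\le M_1$ for all $t\in[0,T]$ and $\sum_{i=1}^m\|A(\tau_i)-A(\tau_{i-1})\|_{\mathcal L(D,X)}\le M_2$ for every partition $0=\tau_0<\tau_1<\dots<\tau_m=T$.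 There is a constant $\lambda\ge1$ with $|\langle A(t)v,v\rangle|\le\lambda\,\mathrm{Re}\,\langle A(t)v,v\rangle$ for all $v\in V$, $t\in[0,T]$. *)

(* Defs.v *)
From HB Require Import structures.
From mathcomp Require Import all_boot all_order all_algebra.
From mathcomp Require Import sesquilinear complex.
From mathcomp Require Import all_classical all_reals all_analysis.

Set Implicit Arguments.
Unset Strict Implicit.
Unset Printing Implicit Defensive.

Import Order.TTheory GRing.Theory Num.Theory.
Import numFieldNormedType.Exports.

Local Open Scope classical_set_scope.
Local Open Scope complex_scope.
Local Open Scope ring_scope.

(* The norm of a normed module over R[i] takes values in R[i]; it is a
   nonnegative real there, and [rnorm] is that real number. *)
Definition rnorm (R : realType) (Y : normedModType R[i]) (y : Y) : R :=
  complex.Re `|y|.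

Definition unit_ball (R : realType) (Y : normedModType R[i]) : set Y :=
  [set y | rnorm y <= 1].

(* The operator norm is +oo for an unbounded operator. *)
Definition opnorm (R : realType) (Y Z : normedModType R[i]) (L : Y -> Z)
    : \bar R :=
  ereal_sup [set (rnorm (L y))%:E | y in @unit_ball R Y].

Definition imbedding (R : realType) (Y Z : normedModType R[i]) (f : Y -> Z) :=
  injective f /\ continuous f.

(* V' is the space of bounded antilinear functionals on V, presented through
   the duality pairing [pair], linear in V' and antilinear in V, which must
   carry the dual norm and represent every such functional. *)
Record gelfand_triple (R : realType) (V H V' : completeNormedModType R[i]) :=
  GelfandTriple {
    dotV : {dot V for Num.conj};
    dotVE : forall v : V, `|v| ^+ 2 = dotV v v;
    dotH : {dot H for Num.conj};
    dotHE : forall h : H, `|h| ^+ 2 = dotH h h;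
    iVH : {linear V -> H};
    iVH_imbedding : imbedding iVH;
    iVH_dense : dense (range iVH);
    pair : {bilinear V' -> V -> R[i] | *%R & Num.conj \; *%R};
    pair_norm : forall l : V',
      (rnorm l)%:E =
        ereal_sup [set (complex.Re `|pair l v|)%:E | v in @unit_ball R V];
    pair_surj : forall f : {linear V -> R[i] | Num.conj \; *%R},
      (exists M : R, forall v : V, complex.Re `|f v| <= M * rnorm v) ->
      exists l : V', forall v : V, pair l v = f v;
    jHV : {linear H -> V'};
    jHVE : forall (h : H) (v : V), pair (jHV h) v = dotH h (iVH v)
  }.

Record imbeddings (R : realType) (V H V' : completeNormedModType R[i])
    (G : gelfand_triple V H V') (D W X : completeNormedModType R[i]) :=
  Imbeddings {
    iDW : {linear D -> W};
    iWX : {linear W -> X};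
    iDV : {linear D -> V};
    jXV : {linear X -> V'};
    iDW_imbedding : imbedding iDW;
    iWX_imbedding : imbedding iWX;
    iDV_imbedding : imbedding iDV;
    jXV_imbedding : imbedding jXV;
    imbeddings_compat : forall d : D,
      jXV (iWX (iDW d)) = jHV G (iVH G (iDV d))
  }.

Definition iDX (R : realType) (V H V' : completeNormedModType R[i])
    (G : gelfand_triple V H V') (D W X : completeNormedModType R[i])
    (S : imbeddings G D W X) (d : D) : X := iWX S (iDW S d).

Section Bochner.
Variables (R : realType) (Y : completeNormedModType R[i]).

Local Notation mu := (@lebesgue_measure R).

Definition simple_fun (s : R -> Y) :=
  finite_set (range s) /\ forall y, measurable (s @^-1` [set y]).

Definition strongly_measurable (I : set R) (f : R -> Y) :=
  exists s : nat -> R -> Y, (forall n, simple_fun (s n)) /\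
    {ae mu, forall t, I t -> s ^~ t @ \oo --> f t}.

Definition simple_integrable (I : set R) (s : R -> Y) :=
  simple_fun s /\
  forall y, y != 0 -> (mu (I `&` s @^-1` [set y]) < +oo)%E.

Definition simple_integral (I : set R) (s : R -> Y) : Y :=
  \sum_(y \in range s `\ 0) (fine (mu (I `&` s @^-1` [set y])))%:C *: y.

Definition is_bochner_integral (I : set R) (f : R -> Y) (y : Y) :=
  strongly_measurable I f /\
  exists s : nat -> R -> Y,
    [/\ forall n, simple_integrable I (s n),
        (\int[mu]_(t in I) (rnorm (f t - s n t))%:E)%E
          @[n --> \oo] --> (0 : \bar R)
      & simple_integral I (s n) @[n --> \oo] --> y].

Definition Rplus : set R := `]0, +oo[%classic.

Definition L2_Rplus (f : R -> Y) :=
  strongly_measurable Rplus f /\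
  (\int[mu]_(t in Rplus) (rnorm (f t) ^+ 2)%:E < +oo)%E.

Definition test_function (phi : R -> R) :=
  (forall n t, derivable (derive1n n phi) t 1) /\
  exists a b : R, 0 < a /\ forall t, phi t != 0 -> a <= t <= b.

Definition weak_derivative (f g : R -> Y) :=
  forall phi : R -> R, test_function phi -> exists y : Y,
    is_bochner_integral Rplus (fun t => (derive1 phi t)%:C *: f t) (- y) /\
    is_bochner_integral Rplus (fun t => (phi t)%:C *: g t) y.

End Bochner.

Section Evolution.
Variables (R : realType) (V H V' : completeNormedModType R[i]).
Variable G : gelfand_triple V H V'.

Local Notation mu := (@lebesgue_measure R).

(* u is the representative in C([0,oo);H) of a function in
   H^1(R_+;V') /\ L^2(R_+;V), with V-valued representative v and weak
   derivative w; only the values of u on [0,oo) matter. *)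
Definition cauchy_solution (B : V -> V') (v0 : H) (u : R -> H) :=
  [/\ {within `[0, +oo[%classic, continuous u}, u 0 = v0
    & exists (v : R -> V) (w : R -> V'),
      [/\ L2_Rplus v,
          {ae mu, forall t, 0 < t -> iVH G (v t) = u t},
          L2_Rplus (fun t => jHV G (u t)) /\ L2_Rplus w,
          weak_derivative (fun t => jHV G (u t)) w
        & {ae mu, forall t, 0 < t -> w t + B (v t) = 0}]].

End Evolution.

(* Principal argument, in ]-pi, pi]. *)
Definition carg (R : realType) (z : R[i]) : R :=
  let a := acos (complex.Re z / complex.Re `|z|) in
  if 0 <= complex.Im z then a else - a.

Definition sector (R : realType) (phi : R) : set R[i] :=
  [set z | z != 0 /\ `|carg z| < phi].

(* Analyticity of z |-> E z is stated strongly, i.e. for each orbit; on proper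
   subsectors the operators are uniformly bounded and strongly continuous
   at 0. *)
Definition bounded_analytic_semigroup (R : realType)
    (H : completeNormedModType R[i]) (phi : R) (E : R[i] -> H -> H) :=
  [/\ forall z, sector phi z -> linear (E z),
      forall z w h, sector phi z -> sector phi w ->
        E (z + w) h = E z (E w h),
      forall z h, sector phi z -> derivable (fun w : R[i]^o => E w h) z 1,
      forall psi, psi < phi -> exists M : R, forall z h,
        sector psi z -> rnorm (E z h) <= M * rnorm h
    & forall psi h, psi < phi ->
        (E z h) @[z --> within (sector psi) (nbhs (0 : R[i]^o))] --> h].

Section Angle.
Variables (R : realType) (V H V' : completeNormedModType R[i]).
Variable G : gelfand_triple V H V'.

Definition analyticity_angles (B : V -> V') : set R :=
  [set phi | 0 < phi <= pi / 2 /\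
    exists E : R[i] -> H -> H, bounded_analytic_semigroup phi E /\
      forall v0 u, cauchy_solution G B v0 u ->
        forall t : R, 0 < t -> E t%:C v0 = u t].

Definition analyticity_angle (B : V -> V') : R := sup (analyticity_angles B).

Definition uniform_angle (T : R) (A : R -> V -> V') : R :=
  inf [set analyticity_angle (A s) | s in `[0, T]%classic].

(* [generator E h g]: h is in the domain of the generator of the semigroup E
   and is mapped to g. *)
Definition generator (E : R -> H -> H) (h g : H) :=
  (t^-1)%:C *: (E t h - h) @[t --> 0^'+] --> g.

Definition assumption_A1 (T : R) (A : R -> V -> V') :=
  [/\ forall (s : R) (v0 : H), 0 <= s <= T ->
        (exists u, cauchy_solution G (A s) v0 u) /\
        (forall u1 u2, cauchy_solution G (A s) v0 u1 ->
           cauchy_solution G (A s) v0 u2 ->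
           forall t : R, 0 <= t -> u1 t = u2 t),
      forall s : R, 0 <= s <= T ->
        analyticity_angles (A s) (analyticity_angle (A s)),
      exists (E : R -> R -> H -> H) (DH : set H),
        [/\ forall (s : R) (v0 : H), 0 <= s <= T ->
              cauchy_solution G (A s) v0 (fun t => E s t v0),
            forall s : R, 0 <= s <= T ->
              [set h | exists g, generator (E s) h g] = DH,
            DH `<=` range (iVH G) /\
            (forall s : R, 0 <= s <= T -> exists c : R,
               forall (v : V) (g : H), generator (E s) (iVH G v) g ->
                 rnorm v <= c * (rnorm (iVH G v) + rnorm g)),
            forall s : R, 0 <= s <= T ->
              precompact [set h | exists2 g, generator (E s) h g &
                                    rnorm h + rnorm g <= 1]
          & forall (s : R) (v : V) (g : H), 0 <= s <= T ->
              generator (E s) (iVH G v) g -> jHV G (- g) = A s v]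
    & 0 < uniform_angle T A].

End Angle.

Section BDF.
Variable R : realType.

Definition bdf_poly (k : nat) : {poly R[i]} :=
  \sum_(1 <= l < k.+1) (l%:R^-1 : R[i]) *: (1 - 'X) ^+ l.

Definition bdf_coef (k i : nat) : R[i] := (bdf_poly k)`_i.

(* For 1 <= k <= 6 the set is nonempty and the supremum is attained. *)
Definition bdf_angle (k : nat) : R :=
  sup [set alpha : R | 0 < alpha <= pi / 2 /\
    forall z : R[i], `|z| <= 1 -> z != 1 ->
      `|carg (bdf_poly k).[z]| <= pi - alpha].

Definition lp_norm (Y : normedModType R[i]) (tau p : R) (a b : nat)
    (v : nat -> Y) : R :=
  (tau * \sum_(a <= n < b.+1) rnorm (v n) `^ p) `^ p^-1.

Variables (V H V' D W X : completeNormedModType R[i]).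
Variables (G : gelfand_triple V H V') (S : imbeddings G D W X).

(* Only the entries v_0, ..., v_N are constrained. *)
Definition bdf_solution (k N : nat) (tau : R) (B : nat -> D -> X)
    (f : nat -> X) (vinit v : nat -> D) :=
  (forall i, (i < k)%N -> v i = vinit i) /\
  forall n, (k <= n <= N)%N ->
    (tau^-1)%:C *: (\sum_(j < k.+1) bdf_coef k j *: iDX S (v (n - j)%N))
      + B n (v n) = f n.

Definition bdf_estimate (k N : nat) (tau p C : R) (f : nat -> X)
    (v : nat -> D) :=
  tau^-1 * lp_norm tau p k N (fun n => iDX S (v n - v n.-1))
    + lp_norm tau p k N v
  <= C * (lp_norm tau p k N f
          + tau^-1 * lp_norm tau p 0 k.-1 (fun i => iDX S (v i))
          + lp_norm tau p 0 k.-1 v).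

Definition bdf_maximal_regularity (k N : nat) (tau p C : R)
    (B : nat -> D -> X) :=
  forall (f : nat -> X) (vinit : nat -> D),
    exists v, [/\ bdf_solution k N tau B f vinit v,
      forall v', bdf_solution k N tau B f vinit v' ->
        forall n, (n <= N)%N -> v' n = v n
    & bdf_estimate k N tau p C f v].

(* [AX t] is A(t) as an operator from D to X. *)
Definition operator_family (T : R) (A : R -> V -> V') (AX : R -> D -> X) :=
  forall t : R, 0 <= t <= T ->
    [/\ linear (A t), continuous (A t)
      & forall d : D, jXV S (AX t d) = A t (iDV S d)].

Definition assumption_A2 (k : nat) (p T : R) (A : R -> V -> V')
    (AX : R -> D -> X) :=
  pi / 2 - bdf_angle k < uniform_angle G T A ->
  exists2 C : R, 0 < C & forall (s : R) (N : nat),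
    0 <= s <= T -> (k <= N)%N ->
    bdf_maximal_regularity k N (T / N%:R) p C (fun=> AX s).

Definition assumption_A3 (T : R) (A : R -> V -> V') (AX : R -> D -> X) :=
  (exists M1 M2 : R,
    [/\ 0 < M1, 0 < M2,
        forall t : R, 0 <= t <= T -> (opnorm (AX t) <= M1%:E)%E
      & forall (m : nat) (r : nat -> R),
          r 0%N = 0 -> r m = T -> (forall i, (i < m)%N -> r i < r i.+1) ->
          (\sum_(i < m) opnorm (fun d => AX (r i.+1) d - AX (r i) d)%R
             <= M2%:E)%E]) /\
  (exists2 lambda : R, 1 <= lambda &
    forall (t : R) (v : V), 0 <= t <= T ->
      complex.Re `|pair G (A t v) v| <= lambda * complex.Re (pair G (A t v) v)).

End BDF.

(* Main.v *)
(* Freeze the operator at t_m: on [k, m] the solution solves the autonomous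
   problem with A(t_m) and the perturbed right-hand side
   f_n + (A(t_m) - A(t_n)) v_n.  With mu_i the operator norm of
   A(t_(i+1)) - A(t_i), bounded variation gives sum_i mu_i <= M, hence
   |A(t_m) - A(t_n)|^p <= M^(p-1) sum_(n <= i < m) mu_i.  After exchanging the
   order of summation, the energies e_m = |(v_n)_(n=k)^m|_(L^p(D))^p satisfy
   e_m <= K + L sum_(k <= i < m) mu_i e_i, and the discrete Gronwall inequality
   bounds them by K exp(L M), without any restriction on the stepsize.
   Unique solvability of the nonautonomous scheme holds because each single
   step delta_0 / tau + A(t_n) is bijective, which is read off from unique
   solvability of the autonomous scheme. *)

From HB Require Import structures.
Require Import Defs.
From mathcomp Require Import all_boot all_order all_algebra.
From mathcomp Require Import sesquilinear complex.
From mathcomp Require Import all_classical all_reals all_analysis.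
From mathcomp Require Import ring lra.

Import Order.TTheory GRing.Theory Num.Theory.
Import numFieldNormedType.Exports.

Local Open Scope complex_scope.
Local Open Scope ring_scope.

Set Implicit Arguments.
Unset Strict Implicit.

(** * Real-valued norms and operator norms over [R[i]] *)

Section RealNorm.
Variables (R : realType) (Y : normedModType R[i]).
Implicit Types y z : Y.

Lemma normr_rnorm y : `|y| = (rnorm y)%:C.
Proof.
rewrite /rnorm; have := normr_ge0 y; case: `|y| => a b.
by rewrite lecE /= => /andP[/eqP -> _].
Qed.

Lemma rnorm_ge0 y : 0 <= rnorm y.
Proof. by rewrite -lecR -normr_rnorm normr_ge0. Qed.

Lemma rnorm0 : rnorm (0 : Y) = 0.
Proof. by rewrite /rnorm normr0. Qed.

Lemma ler_rnormD y z : rnorm (y + z) <= rnorm y + rnorm z.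
Proof. by rewrite -lecR raddfD /= -!normr_rnorm ler_normD. Qed.

Lemma rnormZ (a : R) y : 0 <= a -> rnorm (a%:C *: y) = a * rnorm y.
Proof.
move=> a0; apply: complexI.
rewrite rmorphM /= -!normr_rnorm normrZ; congr (_ * _).
by rewrite ger0_norm // ler0c.
Qed.

End RealNorm.

Lemma opnorm_ge0 (R : realType) (Y Z : normedModType R[i]) (L : Y -> Z) :
  (0 <= opnorm L)%E.
Proof.
apply: (@le_trans _ _ (rnorm (L 0))%:E); first by rewrite lee_fin rnorm_ge0.
by apply: ereal_sup_ubound; exists 0 => //; rewrite /unit_ball /= rnorm0 ler01.
Qed.

(** [opnorm] only tests the unit ball, so a nonzero [y] is scaled to norm one and linearity moves
    the factor out of [L]. *)
Lemma ler_rnorm_opnorm (R : realType) (Y Z : normedModType R[i]) (L : Y -> Z)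
    (M : R) (y : Y) :
  linear L -> (opnorm L <= M%:E)%E -> rnorm (L y) <= M * rnorm y.
Proof.
move=> linL LM.
pose L' : {linear Y -> Z} := HB.pack L (GRing.isLinear.Build _ _ _ _ L linL).
rewrite -[L y]/(L' y); have [->|y0] := eqVneq y 0.
  by rewrite linear0 !rnorm0 mulr0.
have ny0 : 0 < rnorm y by rewrite -ltcR -normr_rnorm normr_gt0.
have : ((rnorm (L' ((rnorm y)^-1%:C *: y)))%:E <= M%:E)%E.
  apply: le_trans LM; apply: ereal_sup_ubound => /=; eexists; last reflexivity.
  by rewrite /unit_ball /= rnormZ ?invr_ge0 ?rnorm_ge0 // mulVf ?gt_eqF.
rewrite lee_fin linearZ /= rnormZ ?invr_ge0 ?rnorm_ge0 //.
by rewrite mulrC ler_pdivrMr.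
Qed.

(** * Discrete weighted $L^p$ norms *)

Section LpNorm.
Variables (R : realType) (Y : normedModType R[i]) (tau p : R).
Hypotheses (tau_ge0 : 0 <= tau) (p_gt1 : 1 < p).
Implicit Types v w : nat -> Y.

Lemma lp_norm_ge0 a b v : 0 <= lp_norm tau p a b v.
Proof. exact: powR_ge0. Qed.

Lemma lp_normXp a b v :
  lp_norm tau p a b v `^ p = tau * \sum_(a <= n < b.+1) rnorm (v n) `^ p.
Proof.
rewrite /lp_norm -powRrM mulVf ?gt_eqF ?(lt_trans ltr01) // powRr1 //.
by rewrite mulr_ge0 // sumr_ge0 // => i _; exact: powR_ge0.
Qed.

Lemma eq_lp_norm a b v w :
  (forall n, (a <= n <= b)%N -> v n = w n) ->
  lp_norm tau p a b v = lp_norm tau p a b w.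
Proof.
move=> vw; rewrite /lp_norm; congr ((_ * _) `^ _).
by apply: eq_big_nat => i ?; rewrite vw.
Qed.

Lemma ler_lp_norm_range a b c v :
  (b <= c)%N -> lp_norm tau p a b v <= lp_norm tau p a c v.
Proof.
move=> bc; have s0 d e : 0 <= \sum_(d <= n < e) rnorm (v n) `^ p.
  by apply: sumr_ge0 => i _; exact: powR_ge0.
apply: ge0_ler_powR; rewrite ?invr_ge0 ?(ltW (lt_trans ltr01 p_gt1)) //.
- by rewrite nnegrE mulr_ge0.
- by rewrite nnegrE mulr_ge0.
rewrite ler_wpM2l //; have [ab|ba] := leqP a b.+1; last by rewrite big_geq // ltnW.
by rewrite (@big_cat_nat _ _ _ b.+1 a c.+1) //= lerDl.
Qed.

End LpNorm.

(** * Elementary inequalities: powers, Gronwall, double sums *)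

Lemma powRD_le (R : realType) (p x y : R) : 0 <= p -> 0 <= x -> 0 <= y ->
  (x + y) `^ p <= 2 `^ p * (x `^ p + y `^ p).
Proof.
move=> p0; wlog xy : x y / x <= y => [H x0 y0|x0 y0].
  have [|/ltW] := leP x y => xy; first exact: H.
  by rewrite (addrC x) (addrC (_ `^ _)); exact: H.
have : (x + y) `^ p <= (2 * y) `^ p.
  by apply: ge0_ler_powR; rewrite // ?nnegrE; lra.
move=> /le_trans; apply; rewrite powRM //.
by rewrite ler_wpM2l ?powR_ge0 // lerDr powR_ge0.
Qed.

(** One factor [x] is kept and [x] to the power [p - 1] is bounded through [M]. Applied to a
    variation, this makes its [p]-th power linear in the [mu i]. *)
Lemma powR_le_linear (R : realType) (p x M : R) : 1 < p -> 0 <= x -> x <= M ->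
  x `^ p <= M `^ (p - 1) * x.
Proof.
move=> p1; rewrite le_eqVlt => /predU1P[<- _|x0 xM].
  by rewrite powR0 ?mulr0 // gt_eqF // (lt_trans ltr01).
have -> : x `^ p = x `^ (p - 1) * x.
  have := @powRD _ x (p - 1) 1.
  by rewrite subrK powRr1 ?(ltW x0) // (gt_eqF x0) implybT; apply.
rewrite ler_wpM2r ?(ltW x0) // ge0_ler_powR ?nnegrE //; lra.
Qed.

(** The whole right-hand side is bounded, so that the induction hypothesis also controls [e m];
    passing to [m.+1] then costs a factor [1 + mu m <= expR (mu m)]. The sums stop before [n], so
    nothing has to be absorbed on the left. *)
Lemma discrete_gronwall (R : realType) (k m : nat) (K : R) (mu e : nat -> R) :
  0 <= K -> (forall n, 0 <= mu n) ->
  (forall n, (k <= n < m)%N -> e n <= K + \sum_(k <= i < n) mu i * e i) ->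
  K + \sum_(k <= i < m) mu i * e i <= K * expR (\sum_(k <= i < m) mu i).
Proof.
move=> K0 mu0; elim: m => [_|m IH H]; first by rewrite !big_geq // addr0 expR0 mulr1.
have [km|mk] := leqP k m; last by rewrite !big_geq // addr0 expR0 mulr1.
have {}IH : K + \sum_(k <= i < m) mu i * e i <= K * expR (\sum_(k <= i < m) mu i).
  by apply: IH => n /andP[kn nm]; apply: H; rewrite kn ltnW.
have em := le_trans (H m (introT andP (conj km (ltnSn m)))) IH.
rewrite !big_nat_recr //= expRD addrA mulrA.
set E := K * _ in IH em *.
have E0 : 0 <= E by rewrite mulr_ge0 // ltW // expR_gt0.
have : E * (1 + mu m) <= E * expR (mu m) by rewrite ler_wpM2l // expR_ge1Dx.
apply: le_trans; rewrite mulrDr mulr1 lerD // (mulrC E) ler_wpM2l //.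
Qed.

Lemma ler_sum_subinterval (R : realType) (mu : nat -> R) (a b N : nat) :
  (forall i, 0 <= mu i) -> (b <= N)%N ->
  \sum_(a <= i < b) mu i <= \sum_(0 <= i < N) mu i.
Proof.
move=> mu0 bN; have [ab|/ltnW ba] := leqP a b; last first.
  by rewrite big_geq // sumr_ge0.
rewrite (@big_cat_nat _ _ _ b 0 N) //= (@big_cat_nat _ _ _ a 0 b) //=.
have h c d : 0 <= \sum_(c <= i < d) mu i by apply: sumr_ge0.
by have := h 0 a; have := h b N; lra.
Qed.

(** Both sides add [mu i * a n] over [k <= n <= i < m]; the term [n = m] on the left has an empty
    tail. *)
Lemma sum_tail_exchange (R : realType) (mu a : nat -> R) (k m : nat) :
  \sum_(k <= n < m.+1) (\sum_(n <= i < m) mu i) * a n =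
  \sum_(k <= i < m) mu i * \sum_(k <= n < i.+1) a n.
Proof.
elim: m => [|m IH].
  by rewrite [RHS]big_geq // big1 // => i _; rewrite big_geq // mul0r.
have [km|mk] := leqP k m; last first.
  rewrite [RHS]big_geq // big_nat_cond big1 // => i /andP[/andP[ki _] _].
  by rewrite big_geq ?mul0r // (leq_trans mk).
rewrite big_nat_recr ?(leq_trans km) //= [X in _ + X * _]big_geq // mul0r addr0.
rewrite [RHS]big_nat_recr //= -IH mulr_sumr -big_split /=.
by apply: eq_big_nat => i /andP[_ im]; rewrite big_nat_recr //= mulrDl.
Qed.

(** * Solvability of the BDF scheme, one step at a time *)

Section Bdf.
Variables (R : realType) (V H V' D W X : completeNormedModType R[i]).
Variables (G : gelfand_triple V H V') (S : imbeddings G D W X).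

Lemma iDX0 : iDX S 0 = 0.
Proof. by rewrite /iDX !linear0. Qed.

(** Linearity is inherited from [A t] through the injectivity of [jXV]. *)
Lemma operator_family_linear (T : R) (A : R -> V -> V') (AX : R -> D -> X) t :
  operator_family S T A AX -> 0 <= t <= T -> linear (AX t).
Proof.
move=> fam /fam[linA _ AXE] a d e; apply: (proj1 (jXV_imbedding S)).
by rewrite linearP !AXE linearP linA.
Qed.

Variables (k : nat) (tau : R).
Hypothesis k_gt0 : (0 < k)%N.

(** The terms of one time step that contain the new value; [bdf_history] collects those with earlier
    values. Solving the scheme amounts to inverting [bdf_step] at each level. *)
Definition bdf_step (B : D -> X) (d : D) : X :=
  (tau^-1)%:C *: (bdf_coef R k 0 *: iDX S d) + B d.

Definition bdf_history (v : nat -> D) (n : nat) : X :=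
  (tau^-1)%:C *: \sum_(j < k) bdf_coef R k j.+1 *: iDX S (v (n - j.+1)%N).

Lemma bdf_step_history (B : D -> X) v n :
  (tau^-1)%:C *: (\sum_(j < k.+1) bdf_coef R k j *: iDX S (v (n - j)%N))
    + B (v n) = bdf_step B (v n) + bdf_history v n.
Proof. by rewrite big_ord_recl subn0 scalerDr /bdf_step addrAC. Qed.

Lemma eq_bdf_history v w n :
  (0 < n)%N -> (forall i, (i < n)%N -> v i = w i) ->
  bdf_history v n = bdf_history w n.
Proof.
move=> n0 vw; congr (_ *: _); apply: eq_bigr => j _.
by rewrite vw // ltn_subrL n0.
Qed.

Lemma bdf_history0 v n :
  (0 < n)%N -> (forall i, (i < n)%N -> v i = 0) -> bdf_history v n = 0.
Proof.
move=> n0 v0; rewrite (@eq_bdf_history v (fun=> 0)) // /bdf_history.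
by rewrite big1 ?scaler0 // => j _; rewrite iDX0 scaler0.
Qed.

Lemma bdf_solution_unique N (B : nat -> D -> X) f vinit v w :
  (forall n, (k <= n <= N)%N -> injective (bdf_step (B n))) ->
  bdf_solution S k N tau B f vinit v -> bdf_solution S k N tau B f vinit w ->
  forall n, (n <= N)%N -> v n = w n.
Proof.
move=> inj [vi vE] [wi wE]; elim/ltn_ind => n IH nN.
have [nk|kn] := ltnP n k; first by rewrite vi // wi.
have knN : (k <= n <= N)%N by rewrite kn.
apply: (inj n) => //; have := vE _ knN; rewrite -(wE _ knN) !bdf_step_history.
rewrite (@eq_bdf_history v w) ?(leq_trans k_gt0) //; first exact: addIr.
by move=> i lin; rewrite IH // (leq_trans (ltnW lin)).
Qed.

Lemma bdf_solution_exists N (B : nat -> D -> X) f vinit :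
  (forall n, (k <= n <= N)%N -> forall x, exists d, bdf_step (B n) d = x) ->
  exists v, bdf_solution S k N tau B f vinit v.
Proof.
elim: N => [|N IH] surj.
  exists vinit; split=> // n /andP[kn]; rewrite leqn0 => /eqP n0.
  by rewrite n0 leqNgt k_gt0 in kn.
have {IH} [|v [vi vE]] := IH.
  by move=> n /andP[kn nN]; apply: surj; rewrite kn ltnW.
have [Nk|kN] := ltnP N.+1 k.
  exists v; split=> // n /andP[kn nN]; apply: vE.
  by have := leq_ltn_trans nN Nk; rewrite ltnNge kn.
have kNN : (k <= N.+1 <= N.+1)%N by rewrite kN leqnn.
have [d dE] := surj N.+1 kNN (f N.+1 - bdf_history v N.+1).
pose w n := if n == N.+1 then d else v n.
have wv n : (n <= N)%N -> w n = v n by rewrite /w; case: eqP => // ->; rewrite ltnn.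
exists w; split=> [i ik|n /andP[kn]].
  by rewrite wv ?vi // -ltnS (leq_trans ik).
have n0 := leq_trans k_gt0 kn.
rewrite leq_eqVlt => /predU1P[->|nN]; rewrite bdf_step_history.
  rewrite {1}/w eqxx dE (@eq_bdf_history w v) ?subrK //.
rewrite wv // (@eq_bdf_history w v) //; last first.
  by move=> i ni; rewrite wv // (leq_trans (ltnW ni)).
by rewrite -bdf_step_history vE // kn.
Qed.

(** With zero starting values and constant source [x], the history at level [k] vanishes, so [v k]
    is a preimage of [x]. *)
Lemma bdf_step_surjective N p C (B : D -> X) :
  (k <= N)%N -> bdf_maximal_regularity S k N tau p C (fun=> B) ->
  forall x, exists d, bdf_step B d = x.
Proof.
move=> kN /(_ (fun=> _) (fun=> 0)) reg x; have [v [[vi vE] _ _]] := reg x.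
exists (v k); have := vE k; rewrite leqnn kN bdf_step_history.
by rewrite bdf_history0 ?addr0 //; apply.
Qed.

(** Two values with the same image, each placed at level [N] after zeros, solve the same scheme: the
    zero levels fit because [B 0 = 0], and no equation follows level [N]. Uniqueness at [N]
    identifies the two values. *)
Lemma bdf_step_injective N p C (B : D -> X) :
  (k <= N)%N -> B 0 = 0 -> bdf_maximal_regularity S k N tau p C (fun=> B) ->
  injective (bdf_step B).
Proof.
move=> kN B0 reg d e de.
pose z u n : D := if n == N then u else 0.
pose f n : X := if n == N then bdf_step B d else 0.
have sol u : bdf_step B u = bdf_step B d ->
    bdf_solution S k N tau (fun=> B) f (fun=> 0) (z u).
  move=> uE; have z0 i : (i < N)%N -> z u i = 0.
    by rewrite /z; case: eqP => // ->; rewrite ltnn.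
  split=> [i ik|n /andP[kn nN]]; first by rewrite z0 // (leq_trans ik).
  have n0 := leq_trans k_gt0 kn.
  rewrite bdf_step_history bdf_history0 // ?addr0; last first.
    by move=> i lin; rewrite z0 // (leq_trans lin).
  rewrite /z /f; case: eqP => // _.
  by rewrite /bdf_step iDX0 B0 !scaler0 addr0.
have [v [_ uniq _]] := reg f (fun=> 0).
have := uniq _ (sol d erefl) N (leqnn N).
by rewrite -(uniq _ (sol e (esym de)) N (leqnn N)) /z eqxx.
Qed.

End Bdf.

(** * The Gronwall argument for real sequences *)

Section EnergyArgument.
Variables (R : realType) (p C M : R) (k N : nat) (mu e P : nat -> R) (F I : R).
Hypotheses (p_gt1 : 1 < p) (C_gt0 : 0 < C).
Hypotheses (mu_ge0 : forall n, 0 <= mu n) (mu_sum : \sum_(0 <= i < N) mu i <= M).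
Hypotheses (F_ge0 : 0 <= F) (P_ge0 : forall m, 0 <= P m) (I_ge0 : 0 <= I).

(** In the application [e m] is the energy, [P m] the norm of the perturbed source, [F] that of [f],
    and [I] the size of the starting data. The prefactor and the exponent come from
    [energy_recursion] followed by Gronwall. *)
Definition energy_growth : R :=
  C `^ p * 2 `^ p * (2 `^ p + 1) * expR (C `^ p * 4 `^ p * M `^ (p - 1) * M).

(** The [p]-th root of the factor obtained by inserting the energy bound into [P_bound]. *)
Definition energy_const : R :=
  (2 `^ p * (1 + M `^ (p - 1) * (M * energy_growth))) `^ p^-1.

Hypothesis eP : forall m, (k <= m <= N)%N -> e m <= (C * (P m + I)) `^ p.
Hypothesis P_bound : forall m, (k <= m <= N)%N ->
  P m `^ p <= 2 `^ p * (F `^ p + M `^ (p - 1) * \sum_(k <= i < m) mu i * e i).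

Let p_gt0 : 0 < p. Proof. exact: lt_trans p_gt1. Qed.

Let powR_mono x y : 0 <= x -> x <= y -> x `^ p <= y `^ p.
Proof.
by move=> x0 xy; apply: ge0_ler_powR; rewrite ?nnegrE ?(ltW p_gt0) ?(le_trans x0).
Qed.

(** One factor [2 ^ p] comes from splitting [P m + I], the other from [P_bound]; together they give
    [4 ^ p]. Both [F] and [I] are bounded by [F + I]. *)
Lemma energy_recursion m : (k <= m <= N)%N ->
  e m <= C `^ p * 2 `^ p * (2 `^ p + 1) * (F + I) `^ p
         + \sum_(k <= i < m) (C `^ p * 4 `^ p * M `^ (p - 1) * mu i) * e i.
Proof.
move=> kmN; apply: le_trans (eP kmN) _.
rewrite powRM ?addr_ge0 ?(ltW C_gt0) //.
have -> : C `^ p * 2 `^ p * (2 `^ p + 1) * (F + I) `^ p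
    + \sum_(k <= i < m) (C `^ p * 4 `^ p * M `^ (p - 1) * mu i) * e i =
  C `^ p * (2 `^ p * (2 `^ p * ((F + I) `^ p + M `^ (p - 1) *
    \sum_(k <= i < m) mu i * e i) + (F + I) `^ p)).
  under eq_bigr do rewrite -mulrA.
  rewrite -mulr_sumr (_ : 4 = 2 * 2 :> R); last by ring.
  by rewrite powRM //; ring.
apply: ler_wpM2l; first exact: powR_ge0.
apply: (le_trans (powRD_le (ltW p_gt0) (P_ge0 _) I_ge0)).
apply: ler_wpM2l; first exact: powR_ge0.
apply: lerD; last by apply: powR_mono => //; rewrite lerDr.
apply: (le_trans (P_bound kmN)).
apply: ler_wpM2l; first exact: powR_ge0.
by rewrite lerD2r; apply: powR_mono => //; rewrite lerDl.
Qed.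

Lemma energy_bound m : (k <= m <= N)%N -> e m <= energy_growth * (F + I) `^ p.
Proof.
move=> /andP[km mN].
pose L := C `^ p * 4 `^ p * M `^ (p - 1); pose K := C `^ p * 2 `^ p * (2 `^ p + 1).
have L0 : 0 <= L by rewrite !mulr_ge0 ?powR_ge0.
have K0 : 0 <= K by rewrite !mulr_ge0 ?addr_ge0 ?powR_ge0.
apply: (le_trans (energy_recursion _)); first by rewrite km.
apply: (le_trans (discrete_gronwall (e := e) (mu := fun i => L * mu i) _ _ _)).
- by rewrite mulr_ge0 ?powR_ge0.
- by move=> n; rewrite mulr_ge0.
- by move=> n /andP[kn nm]; apply: energy_recursion; rewrite kn (leq_trans (ltnW nm)).
rewrite /energy_growth -/K -/L (mulrAC K); apply: ler_wpM2r; first exact: powR_ge0.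
rewrite ler_wpM2l // ler_expR -mulr_sumr.
by rewrite ler_wpM2l // (le_trans (ler_sum_subinterval _ mu_ge0 mN)).
Qed.

Lemma energy_argument m : (k <= m <= N)%N -> P m <= energy_const * (F + I).
Proof.
move=> kmN; have [km mN] := andP kmN.
have M0 : 0 <= M by apply: le_trans mu_sum; apply: sumr_ge0.
have E0 : 0 <= energy_growth.
  by rewrite /energy_growth !mulr_ge0 ?expR_ge0 ?addr_ge0 ?powR_ge0.
have FI0 : 0 <= F + I by rewrite addr_ge0.
have pK x : 0 <= x -> x = (x `^ p) `^ p^-1.
  by move=> x0; rewrite -powRrM mulfV ?gt_eqF // powRr1.
have Q0 : 0 <= 2 `^ p * (1 + M `^ (p - 1) * (M * energy_growth)).
  by rewrite mulr_ge0 ?powR_ge0 // addr_ge0 ?mulr_ge0 ?powR_ge0.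
rewrite (pK (F + I)) // -powRM ?powR_ge0 // [leLHS]pK //; apply: ge0_ler_powR.
- by rewrite invr_ge0 ltW.
- by rewrite nnegrE powR_ge0.
- by rewrite nnegrE mulr_ge0 ?powR_ge0.
apply: le_trans (P_bound kmN) _; rewrite -mulrA.
apply: ler_wpM2l; first exact: powR_ge0.
rewrite mulrDl mul1r; apply: lerD; first by apply: powR_mono => //; rewrite lerDl.
rewrite -mulrA; apply: ler_wpM2l; first exact: powR_ge0.
rewrite -mulrA.
apply: (@le_trans _ _ (\sum_(k <= i < m) mu i * (energy_growth * (F + I) `^ p))).
  apply: ler_sum_nat => i /andP[ki im]; rewrite ler_wpM2l //.
  by rewrite energy_bound // ki (leq_trans (ltnW im)).
rewrite -mulr_suml ler_wpM2r ?mulr_ge0 ?powR_ge0 //.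
exact: le_trans (ler_sum_subinterval _ mu_ge0 mN) mu_sum.
Qed.

End EnergyArgument.

Section BoundedVariation.
Variables (R : realType) (V H V' D W X : completeNormedModType R[i]).
Variables (G : gelfand_triple V H V') (S : imbeddings G D W X).
Variables (k N : nat) (tau p C M : R).
Hypotheses (k_gt0 : (0 < k)%N) (kN : (k <= N)%N).
Hypotheses (tau_gt0 : 0 < tau) (p_gt1 : 1 < p) (C_gt0 : 0 < C).
Variables (B : nat -> D -> X) (mu : nat -> R).
Hypothesis B0 : forall n, (n <= N)%N -> B n 0 = 0.
Hypothesis mu_ge0 : forall n, 0 <= mu n.
Hypothesis B_step : forall i d, (i < N)%N ->
  rnorm (B i.+1 d - B i d) <= mu i * rnorm d.
Hypothesis mu_sum : \sum_(0 <= i < N) mu i <= M.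
Hypothesis frozen : forall m, (m <= N)%N ->
  bdf_maximal_regularity S k N tau p C (fun=> B m).

Lemma increment_bound n m d : (n <= m <= N)%N ->
  rnorm (B m d - B n d) <= (\sum_(n <= i < m) mu i) * rnorm d.
Proof.
elim: m => [|m IH] /andP[nm mN].
  by move: nm; rewrite leqn0 => /eqP ->; rewrite subrr rnorm0 big_geq // mul0r.
move: nm; rewrite leq_eqVlt => /predU1P[->|nm].
  by rewrite subrr rnorm0 big_geq // mul0r.
rewrite -(subrK (B m d) (B m.+1 d)) -addrA big_nat_recr //= mulrDl addrC.
apply: (le_trans (ler_rnormD _ _)); rewrite lerD ?B_step //.
by rewrite IH // -ltnS nm ltnW.
Qed.

Variables (f : nat -> X) (vinit v : nat -> D).
Hypothesis v_sol : bdf_solution S k N tau B f vinit v.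

Let init := tau^-1 * lp_norm tau p 0 k.-1 (fun i => iDX S (v i))
  + lp_norm tau p 0 k.-1 v.

(* Beyond [m] the data of the frozen problem are cut off: the estimate up to
   [m] then only sees the perturbation on [k, m]. *)
Let frozen_data m n : X := if (n <= m)%N then f n + (B m (v n) - B n (v n)) else 0.

Lemma frozen_estimate m : (k <= m <= N)%N ->
  tau^-1 * lp_norm tau p k m (fun n => iDX S (v n - v n.-1))
    + lp_norm tau p k m v
  <= C * (lp_norm tau p k N (frozen_data m) + init).
Proof.
move=> /andP[km mN]; have [vi vE] := v_sol.
have [w [[wi wE] _ west]] := frozen mN (frozen_data m) vinit.
have wv n : (n <= m)%N -> w n = v n.
  have sol_w : bdf_solution S k m tau (fun=> B m) (frozen_data m) vinit w.
    by split=> // i /andP[ki im]; apply: wE; rewrite ki (leq_trans im).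
  apply: (bdf_solution_unique k_gt0 _ sol_w).
    by move=> i /andP[ki im]; apply: (bdf_step_injective k_gt0 kN (B0 mN) (frozen mN)).
  split=> // i /andP[ki im]; rewrite /frozen_data im -(vE i) ?ki ?(leq_trans im) //.
  by rewrite -addrA [B i (v i) + _]addrC subrK.
have init_lt n : (n <= k.-1)%N -> (n <= m)%N.
  by move=> nk; rewrite (leq_trans nk) // (leq_trans (leq_pred _)).
move: west; rewrite /bdf_estimate /init -addrA.
rewrite (@eq_lp_norm _ _ tau p 0 k.-1 _ (fun i => iDX S (v i))); last first.
  by move=> n nk; rewrite wv // init_lt.
rewrite (@eq_lp_norm _ _ tau p 0 k.-1 w v); last by move=> n nk; rewrite wv // init_lt.
move=> west; apply: le_trans west.
rewrite (@eq_lp_norm _ _ tau p k m v w); last by move=> n /andP[_ nm]; rewrite wv.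
rewrite (@eq_lp_norm _ _ tau p k m _ (fun n => iDX S (w n - w n.-1))); last first.
  by move=> n /andP[_ nm]; rewrite !wv // (leq_trans (leq_pred _)).
have tau0 := ltW tau_gt0.
by rewrite lerD ?ler_wpM2l ?invr_ge0 ?ler_lp_norm_range.
Qed.

Let energy m := lp_norm tau p k m v `^ p.

(** The perturbation at level [n] is at most the variation over [[n, m]] times the norm of [v n].
    Its [p]-th power is linearized in the variation, and exchanging the sums produces the
    energies. *)
Lemma frozen_data_bound m : (k <= m <= N)%N ->
  lp_norm tau p k N (frozen_data m) `^ p <=
  2 `^ p * (lp_norm tau p k N f `^ p
            + M `^ (p - 1) * \sum_(k <= i < m) mu i * energy i).
Proof.
move=> /andP[km mN]; have p0 : 0 < p by apply: lt_trans p_gt1.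
have tau0 := ltW tau_gt0.
have -> : \sum_(k <= i < m) mu i * energy i = tau *
    \sum_(k <= n < m.+1) (\sum_(n <= i < m) mu i) * rnorm (v n) `^ p.
  rewrite sum_tail_exchange mulr_sumr; apply: eq_big_nat => i _.
  by rewrite /energy lp_normXp // mulrCA.
rewrite [leLHS]lp_normXp // [X in _ * (X + _)]lp_normXp //.
rewrite [X in _ * (_ + X)]mulrCA -mulrDr.
rewrite [leRHS]mulrCA ler_wpM2l //.
rewrite mulrDr [X in _ * X + _](@big_cat_nat _ _ _ m.+1) //=; last exact: leqW.
rewrite mulrDr (@big_cat_nat _ _ _ m.+1) //=; last exact: leqW.
(* Beyond [m] the cut-off makes the left-hand terms vanish; those of [f] on the right are simply
   discarded. *)
rewrite [X in _ + X <= _]big_nat_cond [X in _ + X <= _]big1 ?addr0; last first.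
  move=> n /andP[/andP[mn _] _].
  by rewrite /frozen_data leqNgt mn /= rnorm0 powR0 // gt_eqF.
apply: (@le_trans _ _ (2 `^ p * \sum_(k <= n < m.+1) rnorm (f n) `^ p +
  2 `^ p * (M `^ (p - 1) *
   \sum_(k <= n < m.+1) (\sum_(n <= i < m) mu i) * rnorm (v n) `^ p))); last first.
  rewrite lerD2r lerDl mulr_ge0 ?powR_ge0 // sumr_ge0 // => i _.
  exact: powR_ge0.
rewrite [M `^ _ * _]mulr_sumr -mulrDr -big_split mulr_sumr /=; apply: ler_sum_nat.
move=> n /andP[kn]; rewrite ltnS => nm; rewrite /frozen_data nm.
apply: (@le_trans _ _
  (2 `^ p * (rnorm (f n) `^ p + rnorm (B m (v n) - B n (v n)) `^ p))).
  apply: le_trans (powRD_le (ltW p0) (rnorm_ge0 _) (rnorm_ge0 _)).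
  by apply: ge0_ler_powR; rewrite ?nnegrE ?ler_rnormD ?addr_ge0 ?rnorm_ge0 ?ltW.
rewrite ler_wpM2l ?powR_ge0 // lerD2l mulrA.
have s0 : 0 <= \sum_(n <= i < m) mu i by apply: sumr_ge0.
apply: (@le_trans _ _ (((\sum_(n <= i < m) mu i) * rnorm (v n)) `^ p)).
  apply: ge0_ler_powR; rewrite ?nnegrE ?mulr_ge0 ?rnorm_ge0 ?(ltW p0) //.
  by apply: increment_bound; rewrite nm mN.
rewrite powRM ?rnorm_ge0 // ler_wpM2r ?powR_ge0 // powR_le_linear //.
exact: le_trans (ler_sum_subinterval _ mu_ge0 mN) mu_sum.
Qed.

Lemma bounded_variation_estimate :
  bdf_estimate S k N tau p (C * (energy_const p C M + 1)) f v.
Proof.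
have tau0 := ltW tau_gt0.
have init0 : 0 <= init.
  by apply: addr_ge0; [apply: mulr_ge0; rewrite ?invr_ge0|]; rewrite ?lp_norm_ge0.
have kNN : (k <= N <= N)%N by rewrite kN leqnn.
have := @energy_argument R p C M k N mu energy
  (fun m => lp_norm tau p k N (frozen_data m)) (lp_norm tau p k N f) init
  p_gt1 C_gt0 mu_ge0 mu_sum (lp_norm_ge0 _ _ _ _ _)
  (fun m => lp_norm_ge0 _ _ _ _ _) init0 _ frozen_data_bound N kNN.
move=> source_bound; rewrite /bdf_estimate -addrA.
apply: (le_trans (frozen_estimate kNN)); rewrite -mulrA.
apply: ler_wpM2l; first exact: ltW.
change (lp_norm tau p k N (frozen_data N) + init <=
  (energy_const p C M + 1) * (lp_norm tau p k N f + init)).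
rewrite mulrDl mul1r; apply: lerD; last by rewrite lerDr lp_norm_ge0.
apply: source_bound => m kmN; apply: ge0_ler_powR; first exact: ltW (lt_trans ltr01 p_gt1).
- exact: lp_norm_ge0.
- exact: mulr_ge0 (ltW C_gt0) (addr_ge0 (lp_norm_ge0 _ _ _ _ _) init0).
apply: le_trans (frozen_estimate kmN).
by rewrite lerDr; apply: mulr_ge0; rewrite ?invr_ge0 ?lp_norm_ge0.
Qed.

End BoundedVariation.

(** * Uniform constant and application to the operators on the grid *)

Lemma bounded_variation_maximal_regularity (R : realType) (p C M : R) :
  1 < p -> 0 < C -> 0 < M -> exists2 C' : R, 0 < C' &
  forall (V H V' D W X : completeNormedModType R[i])
    (G : gelfand_triple V H V') (S : imbeddings G D W X) (k N : nat) (tau : R)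
    (B : nat -> D -> X) (mu : nat -> R),
  (0 < k <= N)%N -> 0 < tau ->
  (forall n, (n <= N)%N -> B n 0 = 0) ->
  (forall n, 0 <= mu n) ->
  (forall i d, (i < N)%N -> rnorm (B i.+1 d - B i d) <= mu i * rnorm d) ->
  \sum_(0 <= i < N) mu i <= M ->
  (forall m, (m <= N)%N ->
     bdf_maximal_regularity S k N tau p C (fun=> B m)) ->
  bdf_maximal_regularity S k N tau p C' B.
Proof.
(* The constant is left open and read off the final estimate; it involves only [p], [C] and [M],
   hence is uniform in [N] and [tau]. *)
move=> p1 C0 M0; eexists; last first.
  move=> V H V' D W X G S k N tau B mu /andP[k0 kN] tau0 B0 mu0 Bmu muM froz f vinit.
  have surj n : (k <= n <= N)%N -> forall x, exists d, bdf_step S k tau (B n) d = x.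
    by move=> /andP[_ nN]; exact: bdf_step_surjective (froz n nN).
  have [v vsol] := bdf_solution_exists k0 f vinit surj.
  exists v; split=> //.
    move=> w wsol; apply: (bdf_solution_unique k0 _ wsol vsol) => n /andP[_ nN].
    exact: (bdf_step_injective k0 kN (B0 n nN) (froz n nN)).
  exact: (bounded_variation_estimate k0 kN tau0 p1 C0 B0 mu0 Bmu muM froz vsol).
by rewrite mulr_gt0 // ltr_wpDl ?powR_ge0.
Qed.

Unset Implicit Arguments.
Set Strict Implicit.

Theorem proposition3p1 (R : realType) (k : nat) (p T : R)
    (V H V' D W X : completeNormedModType R[i])
    (G : gelfand_triple V H V') (S : imbeddings G D W X)
    (A : R -> V -> V') (AX : R -> D -> X) :
  (1 <= k <= 6)%N -> 1 < p -> 0 < T ->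
  operator_family S T A AX ->
  assumption_A1 G T A -> assumption_A2 S k p T A AX ->
  assumption_A3 G T A AX ->
  pi / 2 - bdf_angle R k < uniform_angle G T A ->
  exists tau0 C : R, [/\ 0 < tau0, 0 < C &
    forall N : nat, (k <= N)%N -> T / N%:R <= tau0 ->
      bdf_maximal_regularity S k N (T / N%:R) p C
        (fun n => AX (n%:R * (T / N%:R)))].
Proof.
move=> /andP[k0 _] p1 T0 fam _ A2 [[_ [M [_ M0 _ bv]]] _] angle.
have [C C0 frozen] := A2 angle.
have [C' C'0 reg] := bounded_variation_maximal_regularity p1 C0 M0.
(* [1] is an arbitrary positive choice, since [reg] holds for every positive stepsize. *)
exists 1, C'; split=> // N kN _.
have N0 : (0 < N)%N by exact: leq_trans k0 kN.
have tau0 : 0 < T / N%:R by rewrite divr_gt0 // ltr0n.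
pose t n : R := n%:R * (T / N%:R).
have tT n : (n <= N)%N -> 0 <= t n <= T.
  move=> nN; rewrite mulr_ge0 ?(ltW tau0) //= /t mulrCA ger_pMr //.
  by rewrite ler_pdivrMr ?ltr0n // mul1r ler_nat.
have linAX n (nN : (n <= N)%N) := operator_family_linear fam (tT n nN).
pose delta i d := AX (t i.+1) d - AX (t i) d.
have delta_sum : (\sum_(i < N) opnorm (delta i) <= M%:E)%E.
  (* The time grid itself serves as the partition of [[0, T]]. *)
  apply: bv => [||i _]; first by rewrite /t mul0r.
    by rewrite /t mulrCA divff ?mulr1 // pnatr_eq0 -lt0n.
  by rewrite /t ltr_pM2r // ltr_nat.
(* Each increment is a term of a nonnegative sum bounded by [M], hence finite, so [fine] below keeps
   its value. *)
have delta_fin i : (i < N)%N -> opnorm (delta i) \is a fin_num.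
  move=> iN; rewrite ge0_fin_numE ?opnorm_ge0 //.
  apply: le_lt_trans (ltry M); apply: le_trans delta_sum.
  rewrite (bigD1 (Ordinal iN)) //= leeDl // sume_ge0 // => j _.
  exact: opnorm_ge0.
apply: (reg _ _ _ _ _ _ _ _ _ _ _ _ (fun i => fine (opnorm (delta i)))) => //.
- by rewrite k0.
(* Linearity at zero arguments reads [B n 0 = B n 0 + B n 0]. *)
- move=> n nN; have := linAX n nN 1 0 0; rewrite !scale1r addr0 => /eqP.
  by rewrite -subr_eq0 opprD addNKr oppr_eq0 => /eqP.
- by move=> n; rewrite fine_ge0 ?opnorm_ge0.
- move=> i d iN; apply: (@ler_rnorm_opnorm _ _ _ (delta i)).
    move=> a x y; rewrite /delta (linAX _ iN) (linAX _ (ltnW iN)) scalerBr.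
    by rewrite opprD addrACA.
  by rewrite fineK ?delta_fin.
- rewrite big_mkord -lee_fin -sumEFin (eq_bigr (fun i : 'I_N => opnorm (delta i))) //.
  by move=> i _; rewrite fineK ?delta_fin.
- move=> m mN; exact: frozen (tT m mN) kN.
Qed.
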